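(* Every poset $P$ of width $2$ satisfies $\operatorname{qn}(P)\leq 2$.
   Context: All posets are finite and nonempty. For elements $a,b$ of a poset $P$, write $a \prec b$ (a cover relation, or cover) if $a<b$ and there is no $c\in P$ with $a<c<b$. The width of $P$ is the maximum number of pairwise incomparable elements. A linear extension $L$ of $P$ is a linear order on the elements of $P$ such that $x<_L y$ whenever $x<_P y$. A rainbow of size $k$ (a $k$-rainbow) with respect to $L$ is a set of $k$ covers $a_1\prec b_1,\dots,a_k\prec b_k$ of $P$ with $a_1<_L\cdots<_L a_k<_L b_k<_L\cdots<_L b_1$. The queue-number $\operatorname{qn}(P)$ is the smallest $k$ such that there is a linear extension $L$ of $P$ with respect to which the covers of $P$ contain no $(k+1)$-rainbow. *)

(* Defs.v *)
From mathcomp Require Import all_boot all_order.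

Set Implicit Arguments.
Unset Strict Implicit.
Unset Printing Implicit Defensive.

Import Order.TTheory.

Local Open Scope order_scope.

Definition covers {d : Order.disp_t} {P : finPOrderType d} (a b : P) : bool :=
  (a < b) && ~~ [exists c : P, (a < c) && (c < b)].

Definition antichain {d : Order.disp_t} {P : finPOrderType d}
    (A : {set P}) : bool :=
  [forall x in A, forall y in A, (x != y) ==> (x >< y)].

Definition width {d : Order.disp_t} (P : finPOrderType d) : nat :=
  (\max_(A : {set P} | antichain A) #|A|)%N.

(* [L] is the strict relation <_L of the linear order. *)
Definition linear_extension {d : Order.disp_t} (P : finPOrderType d)
    (L : rel P) : bool :=
  [&& [forall x, ~~ L x x],
      [forall x, forall y, forall z, L x y ==> L y z ==> L x z],
      [forall x, forall y, [|| x == y, L x y | L y x]]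
    & [forall x : P, forall y : P, (x < y) ==> L x y]].

(* [:: (a_1, b_1); ...; (a_k, b_k)] is a rainbow when every (a_i, b_i) is a
   cover and a_1 <_L ... <_L a_k <_L b_k <_L ... <_L b_1. *)
Definition rainbow {d : Order.disp_t} {P : finPOrderType d}
    (L : rel P) (s : seq (P * P)) : bool :=
  all (fun c => covers c.1 c.2) s
  && sorted L ([seq c.1 | c <- s] ++ rev [seq c.2 | c <- s]).

Definition has_rainbow {d : Order.disp_t} {P : finPOrderType d}
    (L : rel P) (k : nat) : bool :=
  [exists s : k.-tuple (P * P), rainbow L s].

(* A relation on a finite type given by its graph, so that one can quantify
   over all relations on [P] with a boolean [exists]. *)
Definition rel_of {T : finType} (G : {set T * T}) : rel T :=
  fun x y => (x, y) \in G.

Definition queue_layout {d : Order.disp_t} (P : finPOrderType d)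
    (k : nat) : bool :=
  [exists G : {set P * P},
     linear_extension (rel_of G) && ~~ has_rainbow (rel_of G) k.+1].

Lemma queue_layout_exists {d : Order.disp_t} (P : finPOrderType d) :
  exists k, queue_layout P k.
Proof.
pose h (x : P) := #|[set z : P | z < x]|.
pose R (x y : P) :=
  (h x < h y)%N || (h x == h y) && (enum_rank x < enum_rank y)%N.
have RE x y : rel_of [set p | R p.1 p.2] x y = R x y by rewrite /rel_of inE.
exists #|P|; apply/existsP; exists [set p | R p.1 p.2].
have irrR x : R x x = false by rewrite /R !ltnn andbF.
have trR : transitive R.
  move=> y x z /orP[xy|/andP[/eqP xy rxy]] /orP[yz|/andP[/eqP yz ryz]].
  - by rewrite /R (ltn_trans xy yz).
  - by rewrite /R -yz xy.
  - by rewrite /R xy yz.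
  - by rewrite /R xy yz eqxx (ltn_trans rxy ryz) orbT.
apply/andP; split.
  apply/and4P; split.
  - by apply/forallP=> x; rewrite RE irrR.
  - apply/'forall_forallP=> x y; apply/forallP=> z; rewrite !RE.
    by apply/implyP=> xy; apply/implyP=> yz; apply: trR xy yz.
  - apply/'forall_forallP=> x y; rewrite !RE /R.
    case: (ltngtP (h x) (h y)) => _; rewrite ?orbT //=.
    case: ltngtP => //=; rewrite ?orbT // => /val_inj/enum_rank_inj ->.
    by rewrite eqxx.
  - apply/'forall_forallP=> x y; apply/implyP=> xy; rewrite RE /R.
    apply/orP; left; apply: proper_card; apply/properP; split.
      by apply/subsetP=> z; rewrite !inE => /lt_trans; apply.
    by exists x; rewrite !inE ?ltxx.
apply/negP=> /existsP[s /andP[_]].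
rewrite (eq_sorted RE) => srt.
have := sorted_uniq trR irrR srt.
rewrite cat_uniq => /andP[/card_uniqP u _].
by have := max_card (mem [seq c.1 | c <- s]); rewrite u size_map size_tuple ltnn.
Qed.

Definition queue_number {d : Order.disp_t} (P : finPOrderType d) : nat :=
  ex_minn (queue_layout_exists P).

(* Main.v *)
Require Import Defs.
From mathcomp Require Import all_boot all_order.

(** The poset is the union of two chains, recorded as a two-colouring in which
    elements of the same colour are comparable.  Build a linear extension that
    is lazy: at each step it appends a minimal remaining element, and it stays
    on the current chain whenever it can.  It leaves the chain of [y] for an
    element [x] of the other chain only when all remaining elements [z] of the
    first chain are blocked by [x], that is [x < z].

    Consider a cover [a] below [b], and an element or a pair of elements
    strictly between [a] and [b] in the lazy order.
    - If [a] and [b] have the same colour, every element between them has the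
      other colour, since otherwise it would lie between them in the poset
      ([cover_same_color]).
    - If [a] and [b] have different colours, then between them the elements
      coloured like [a] come before the elements coloured like [b]
      ([cover_diff_color]): at a switch back from the chain of [b] to the chain
      of [a], laziness gives an element [x] of the chain of [a] with
      [a < x < b], contrary to the cover.
    - Two nested covers do not have the same pair of colours
      ([nested_covers_color]): the endpoints would form a chain of four
      elements in the poset.
    A case check on the colours of the six endpoints shows that these facts
    exclude a 3-rainbow.

    The two chains come from the case of Dilworth's theorem for posets without
    antichains of three elements ([two_chain_coloring]), proved by removing a
    minimal element, in the spirit of Galvin's proof. *)

Set Implicit Arguments.
Unset Strict Implicit.
Unset Printing Implicit Defensive.

Import Order.TTheory.

Local Open Scope order_scope.

Lemma ex_minimal_le d (P : finPOrderType d) (A : {set P}) (x : P) :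
  x \in A ->
  exists m, [/\ m \in A, m <= x & forall y, y \in A -> ~~ (y < m)].
Proof.
move=> xA; pose h (y : P) := #|[set w : P | w < y]|.
have x_ok : (x \in A) && (x <= x) by rewrite xA lexx.
case: (@arg_minnP _ x (fun y => (y \in A) && (y <= x)) h x_ok) => m /andP[mA mx] m_min.
exists m; split=> // y yA; apply/negP=> ym.
have := m_min y; rewrite yA (le_trans (ltW ym) mx) => /(_ isT).
rewrite leqNgt => /negP; apply; apply: proper_card; apply/properP; split.
  by apply/subsetP=> w; rewrite !inE => /lt_trans; apply.
by exists y; rewrite !inE ?ltxx.
Qed.

Definition no_antichain3 d (P : porderType d) : Prop :=
  forall x y z : P, x >< y -> x >< z -> y >< z -> False.

Lemma width2_no_antichain3 d (P : finPOrderType d) :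
  (width P <= 2)%N -> no_antichain3 P.
Proof.
move=> w2 x y z xy xz yz.
have ac : antichain [set x; y; z].
  apply/'forall_implyP=> u; rewrite !inE => /orP[/orP[]|] /eqP->;
    apply/'forall_implyP=> v; rewrite !inE => /orP[/orP[]|] /eqP->;
    by rewrite ?eqxx ?xy ?xz ?yz ?implybT // comparable_sym ?xy ?xz ?yz implybT.
have neq (u v : P) : u >< v -> u != v.
  by apply: contraNneq => ->; exact: comparablexx.
have := leq_trans (leq_bigmax_cond _ ac) w2.
by rewrite setUC cardsU1 cards2 !inE negb_or ![z == _]eq_sym !neq.
Qed.

(** * Two chains *)

(** The configuration that obstructs adding the minimal element [a] to a
    two-colouring.  The element [y] cannot be above [v], because it would be
    above [u]; below [v] it is not above [a], so that [y], [u] and [a] form an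
    antichain. *)
Lemma no_crossing_at_minimal d (P : porderType d) (a u v y : P) :
  no_antichain3 P -> ~~ (y < a) -> y != a ->
  a >< u -> a >< v -> u < v -> u >< y -> v >=< y -> False.
Proof.
move=> no3 yNa ya au av uv uy vy.
case/orP: vy => [vy|yv].
  by move/negP: uy; apply; rewrite /Order.comparable (ltW (lt_le_trans uv vy)).
apply: (no3 a u y) => //; apply/negP => /orP[ay|ya'].
  by move/negP: av; apply; rewrite /Order.comparable (le_trans ay yv).
by move: yNa; rewrite lt_neqAle ya ya'.
Qed.

(** Let [a] be minimal in [S] and let the rest of [S] be coloured by [c].
    Elements comparable to all the rest can take either colour; call the others
    tied.  If for some colour [b] all tied elements of colour [b] lie above [a],
    then [a] and these elements form a chain, and so do the remaining ones.
    Otherwise each colour has a tied element incomparable to [a]; these two are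
    comparable, and the smaller one with an element to which it is tied gives
    the configuration of [no_crossing_at_minimal]. *)
Lemma two_chain_coloring_in d (P : finPOrderType d) (S : {set P}) :
  no_antichain3 P ->
  exists c : P -> bool, {in S &, forall x y, c x = c y -> x >=< y}.
Proof.
move=> no3; have [n] := ubnP #|S|; elim: n S => // n IHn S /ltnSE leSn.
have [->|[x0 x0S]] := set_0Vmem S.
  by exists xpredT => x; rewrite inE.
have [a [aS _ a_min]] := ex_minimal_le x0S.
have [|c chain_c] := IHn (S :\ a).
  by apply: leq_trans leSn; rewrite [X in (_ < X)%N](cardsD1 a) aS.
pose tied x := [exists y in S :\ a, x >< y].
have free x y : ~~ tied x -> y \in S :\ a -> x >=< y.
  by rewrite negb_exists_in => /'forall_implyP H /H; rewrite negbK.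
have [/existsP[b /'forall_implyP above_a]|] :=
  boolP [exists b, [forall x in S :\ a, (tied x && (c x == b)) ==> (a < x)]].
  pose c' x := (x == a) || tied x && (c x == b).
  have c'a x : x \in S -> c' x -> a >=< x.
    move=> xS; have [->|xa] := eqVneq x a; first by rewrite comparablexx.
    rewrite /c' (negPf xa) /= => cx; apply: lt_comparable.
    by have := above_a x; rewrite !inE xa xS cx; apply.
  exists c' => x y xS yS.
  have [->|xa] := eqVneq x a.
    by rewrite {1}/c' eqxx => /esym; apply: c'a.
  have [->|ya] := eqVneq y a.
    by rewrite {2}/c' eqxx comparable_sym; apply: c'a.
  have xS' : x \in S :\ a by rewrite !inE xa.
  have yS' : y \in S :\ a by rewrite !inE ya.
  rewrite /c' (negPf xa) (negPf ya) /=.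
  have [tx|/free fx _] := boolP (tied x); last exact: fx.
  have [ty|/free fy _] := boolP (tied y); last by rewrite comparable_sym fy.
  move=> /= cxy; apply: chain_c => //.
  by case: (c x) (c y) b cxy {above_a c' c'a} => [] [] [].
rewrite negb_exists => /forallP blocked; exfalso.
have tied_at b : exists x, [/\ x \in S :\ a, tied x, c x = b & a >< x].
  have := blocked b; rewrite negb_forall_in => /exists_inP[x xS].
  rewrite negb_imply => /andP[/andP[tx /eqP cx] aNx].
  exists x; split=> //; move: xS; rewrite !inE => /andP[xa xS].
  apply/negP=> /orP[ax|]; first by rewrite lt_neqAle eq_sym xa ax in aNx.
  by rewrite le_eqVlt (negPf xa) (negPf (a_min _ xS)).
have no_lt u v : u \in S :\ a -> v \in S :\ a -> tied u -> c v = ~~ c u ->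
  a >< u -> a >< v -> u < v -> False.
  move=> uS vS /exists_inP[y yS uy] cvu au av uv.
  have vy : v >=< y.
    have cuy : c u != c y by apply: contraNneq uy => cuy; apply: chain_c.
    by apply: chain_c => //; rewrite cvu; case: (c u) (c y) cuy => [] [].
  move: yS; rewrite !inE => /andP[ya yS].
  exact: (no_crossing_at_minimal no3 (a_min _ yS) ya au av uv uy vy).
have [u [uS tu cu au]] := tied_at true.
have [v [vS tv cv av]] := tied_at false.
have [uv|vu|uv|uv] := comparableP u v.
- by apply: (no_lt u v) => //; rewrite cu cv.
- by apply: (no_lt v u) => //; rewrite cu cv.
- by apply: (no3 a u v) => //; apply: uv.
- by move: cv; rewrite -uv cu.
Qed.

Lemma two_chain_coloring d (P : finPOrderType d) :
  no_antichain3 P ->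
  exists c : P -> bool, forall x y, c x = c y -> x >=< y.
Proof.
move=> no3; have [c chain_c] := two_chain_coloring_in [set: P] no3.
by exists c => x y; apply: chain_c; rewrite inE.
Qed.

(** * Lazy linear extensions *)

(** Here [b] is the colour of the element that precedes [s], so that a change of
    colour is allowed only when the head of [s] blocks the chain just left. *)
Fixpoint lazy_seq d (P : porderType d) (c : P -> bool) (b : bool) (s : seq P) :=
  if s is x :: s' then
    ((c x == b) || all (fun z => (c z == b) ==> (x < z)) s')
    && lazy_seq c (c x) s'
  else true.

(** If no minimal element of [S] has colour [b], there is just one minimal
    element, because the minimal elements form an antichain of one colour;
    hence it is below all the others. *)
Lemma ex_lazy_seq d (P : finPOrderType d) (c : P -> bool) (S : {set P}) b :
  (forall x y, c x = c y -> x >=< y) ->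
  exists s, [/\ s =i S, pairwise (fun x y => ~~ (y <= x)) s & lazy_seq c b s].
Proof.
move=> chain_c; have [n] := ubnP #|S|.
elim: n S b => // n IHn S b /ltnSE leSn.
have [->|[x0 x0S]] := set_0Vmem S.
  by exists [::]; split=> // x; rewrite inE.
suff [x [xS x_min x_lazy]] : exists x, [/\ x \in S,
    forall y, y \in S -> ~~ (y < x) &
    c x = b \/ forall z, z \in S :\ x -> c z = b -> x < z].
  have [|s [sE s_pw s_lazy]] := IHn (S :\ x) (c x).
    by apply: leq_trans leSn; rewrite [X in (_ < X)%N](cardsD1 x) xS.
  exists (x :: s); split.
  - by move=> y; rewrite in_cons sE !inE; case: eqVneq => // ->.
  - rewrite /= s_pw andbT; apply/allP=> y; rewrite sE !inE => /andP[yx yS].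
    by rewrite le_eqVlt (negPf yx) x_min.
  - rewrite /= s_lazy andbT; case: x_lazy => [->|x_lt]; first by rewrite eqxx.
    apply/orP; right; apply/allP=> z; rewrite sE => zS.
    by apply/implyP=> /eqP; apply: x_lt.
have [/exists_inP[x xS /andP[/eqP cx /'forall_implyP x_min]]|no_b] :=
    boolP [exists x in S, (c x == b) && [forall y in S, ~~ (y < x)]].
  by exists x; split; [| |left].
have min_color m : m \in S -> (forall y, y \in S -> ~~ (y < m)) -> c m = ~~ b.
  move=> mS m_min; have [cm|] := eqVneq (c m) b; last by case: (c m) (b) => [] [].
  case/negP: no_b; apply/exists_inP; exists m => //; rewrite cm eqxx.
  by apply/'forall_implyP.
have [x [xS _ x_min]] := ex_minimal_le x0S.
exists x; split=> //; right=> z; rewrite !inE => /andP[zx zS] _.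
have [m [mS mz m_min]] := ex_minimal_le zS.
suff xm : x = m by rewrite lt_neqAle eq_sym zx xm.
have /comparable_ltgtP : x >=< m by apply: chain_c; rewrite !min_color.
by case=> // lt; move: (x_min _ mS) (m_min _ xS); rewrite lt.
Qed.

Lemma lazy_seq_blocked d (P : porderType d) (c : P -> bool) b s (x z : P) :
  lazy_seq c b s -> z \in s -> (index x s < index z s)%N ->
  c z = b -> c x = ~~ b ->
  exists x', [/\ x' \in s, c x' = c x & x' < z].
Proof.
elim: s b => //= h s IHs b /andP[h_lazy s_lazy].
have [->|hz] := eqVneq h z; first by rewrite ltn0.
rewrite inE eq_sym (negPf hz) /= => zs lt_xz cz cx.
have [ch|ch] := eqVneq (c h) b; last first.
  exists h; split; first exact: mem_head.
    by rewrite cx; case: (c h) b ch {h_lazy IHs cz cx} => [] [].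
  move: h_lazy; rewrite (negPf ch) /= => /allP/(_ z zs).
  by rewrite cz eqxx.
have hx : h != x.
  by apply: contraTneq isT => hx; move: cx; rewrite -hx ch; case: (b).
move: lt_xz; rewrite (negPf hx) ltnS => lt_xz.
have [|x' [x's cx' x'z]] := IHs b _ zs lt_xz cz cx; first by rewrite -ch.
by exists x'; split=> //; rewrite in_cons x's orbT.
Qed.

(** What laziness leaves once the construction is forgotten.  The witness [x']
    may come after [x]: to place it in the poset above the elements of its chain
    that precede [y], it is enough that it comes after [y]. *)
Definition lazy_order d (P : porderType d) (c : P -> bool) (L : rel P) : Prop :=
  forall y x z, L y x -> L x z -> c y = c z -> c x = ~~ c z ->
  exists x', [/\ L y x', c x' = c x & x' < z].

Lemma lazy_seq_order d (P : porderType d) (c : P -> bool) b (s : seq P) :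
  uniq s -> (forall x, x \in s) -> lazy_seq c b s ->
  lazy_order c (fun x y => index x s < index y s)%N.
Proof.
move=> s_uniq s_full s_lazy y x z yx xz cyz cx.
suff [x' [_ yx' cx' x'z]] : exists x', [/\ x' \in s,
    (index y s < index x' s)%N, c x' = c x & x' < z] by exists x'.
have := s_full z; elim: s b s_uniq s_lazy yx xz {s_full} => //= h s IHs b.
move=> /andP[hs s_uniq] /andP[_ s_lazy].
have [<-|hx] := eqVneq h x; first by rewrite ltn0.
have [<-|hz] := eqVneq h z; first by rewrite ltn0.
rewrite [z \in _]in_cons [z == h]eq_sym (negPf hz) /=.
have neq_h x' : x' \in s -> h != x'.
  by apply: contraTneq => <-.
have [hy _|hy] := eqVneq h y => xz zs.
  have chz : c h = c z by rewrite hy.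
  rewrite chz in s_lazy.
  have [x' [x's cx' x'z]] := lazy_seq_blocked s_lazy zs xz erefl cx.
  by exists x'; rewrite in_cons x's orbT (negPf (neq_h _ x's)).
move=> zs'; have [x' [x's yx' cx' x'z]] := IHs _ s_uniq s_lazy xz zs zs'.
by exists x'; rewrite in_cons x's orbT (negPf (neq_h _ x's)).
Qed.

Lemma index_linear_extension d (P : finPOrderType d) (s : seq P) :
  (forall x, x \in s) -> pairwise (fun x y => ~~ (y <= x)) s ->
  linear_extension (fun x y : P => index x s < index y s)%N.
Proof.
move=> s_full s_pw.
have idx_inj x y : index x s = index y s -> x = y.
  exact: (index_inj x).
apply/and4P; split.
- by apply/forallP=> x; rewrite ltnn.
- apply/'forall_forallP=> x y; apply/forallP=> z.
  by apply/implyP=> xy; apply/implyP; apply: ltn_trans.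
- apply/'forall_forallP=> x y; case: ltngtP; rewrite ?orbT //.
  by move=> /idx_inj ->; rewrite eqxx.
apply/'forall_forallP=> x y; apply/implyP=> xy.
case: ltngtP => // [lt_yx|/idx_inj xy']; last first.
  by rewrite xy' ltxx in xy.
have := elimT (pairwiseP x) s_pw _ _ _ _ lt_yx.
by rewrite !inE !index_mem !s_full !nth_index // (ltW xy) => /(_ isT isT).
Qed.

(** * Covers in a lazy linear extension *)

Lemma coversP d (P : finPOrderType d) (a b : P) :
  covers a b -> forall x, a < x -> x < b -> False.
Proof.
by case/andP=> _ /existsPn Nab x ax xb; move: (Nab x); rewrite ax xb.
Qed.

Lemma linear_extension_trans d (P : finPOrderType d) (L : rel P) :
  linear_extension L -> transitive L.
Proof.
case/and4P=> _ /'forall_forallP tr _ _ y x z xy yz.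
by have /forallP/(_ z) := tr x y; rewrite xy yz.
Qed.

Lemma linear_extension_same_color d (P : finPOrderType d) (c : P -> bool)
    (L : rel P) (x y : P) :
  (forall x y, c x = c y -> x >=< y) -> linear_extension L ->
  L x y -> c x = c y -> x < y.
Proof.
move=> chain_c Lext xy /chain_c/comparable_ltgtP.
have /and4P[/forallP irr _ _ /'forall_forallP ext] := Lext.
case=> // [yx|e]; last by move: (irr x); rewrite {2}e xy.
have := ext y x; rewrite yx => /= Lyx.
by have := irr x; rewrite (linear_extension_trans Lext xy Lyx).
Qed.

Lemma cover_same_color d (P : finPOrderType d) (c : P -> bool) (L : rel P)
    (a b x : P) :
  (forall x y, c x = c y -> x >=< y) -> linear_extension L ->
  covers a b -> L a x -> L x b -> ~ (c a = c b /\ c x = c a).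
Proof.
move=> chain_c Lext /coversP ab ax xb [cab cxa].
have lt := linear_extension_same_color chain_c Lext.
by apply: (ab x); apply: lt; rewrite // cxa.
Qed.

Lemma cover_diff_color d (P : finPOrderType d) (c : P -> bool) (L : rel P)
    (a b y x : P) :
  (forall x y, c x = c y -> x >=< y) -> linear_extension L ->
  lazy_order c L -> covers a b -> L a y -> L y x -> L x b ->
  ~ [/\ c a = ~~ c b, c y = c b & c x = c a].
Proof.
move=> chain_c Lext Llazy /coversP ab ay yx xb [cab cyb cxa].
have [|x' [yx' cx' x'b]] := Llazy _ _ _ yx xb cyb; first by rewrite cxa.
apply: (ab x') => //.
apply: (linear_extension_same_color chain_c Lext); last by rewrite cx'.
exact: linear_extension_trans ay yx'.
Qed.

Lemma nested_covers_color d (P : finPOrderType d) (c : P -> bool) (L : rel P)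
    (a b a' b' : P) :
  (forall x y, c x = c y -> x >=< y) -> linear_extension L ->
  covers a b -> covers a' b' -> L a a' -> L b' b ->
  ~ (c a = c a' /\ c b = c b').
Proof.
move=> chain_c Lext /coversP ab /andP[a'b' _] aa' b'b [ca cb].
have lt := linear_extension_same_color chain_c Lext.
apply: (ab a'); first exact: lt.
by apply: (lt_trans a'b'); apply: lt.
Qed.

Lemma lazy_no_rainbow3 d (P : finPOrderType d) (c : P -> bool) (L : rel P) :
  (forall x y, c x = c y -> x >=< y) -> linear_extension L ->
  lazy_order c L -> ~~ has_rainbow L 3.
Proof.
move=> chain_c Lext Llazy; apply/existsP=> -[[s /= /eqP size_s]].
case: s size_s => [|[a1 b1] [|[a2 b2] [|[a3 b3] []]]] //= _.
rewrite /rainbow /rev /= !andbT => /andP[/and3P[k1 k2 k3]].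
move=> /and5P[a12 a23 ab3 b32 b21].
have tr := linear_extension_trans Lext.
have a2b3 := tr _ _ _ a23 ab3; have a3b2 := tr _ _ _ ab3 b32.
have a2b2 := tr _ _ _ a2b3 b32; have a2b1 := tr _ _ _ a2b2 b21.
have a1b2 := tr _ _ _ a12 a2b2; have a1a3 := tr _ _ _ a12 a23.
have b31 := tr _ _ _ b32 b21.
have same := cover_same_color chain_c Lext.
have diff := cover_diff_color chain_c Lext Llazy.
have nested := nested_covers_color chain_c Lext.
have := same _ _ _ k1 a12 a2b1; have := same _ _ _ k1 a1b2 b21.
have := same _ _ _ k1 a1a3 (tr _ _ _ a3b2 b21); have := same _ _ _ k2 a23 a3b2.
have := diff _ _ _ _ k1 a12 a2b2 b21.
have := diff _ _ _ _ k1 a12 a23 (tr _ _ _ a3b2 b21).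
have := diff _ _ _ _ k1 a1a3 ab3 b31.
have := diff _ _ _ _ k1 (tr _ _ _ a12 a2b3) b32 b21.
have := nested _ _ _ _ k1 k2 a12 b21; have := nested _ _ _ _ k1 k3 a1a3 b31.
have := nested _ _ _ _ k2 k3 a23 b32.
(* Each of the 64 colourings of the endpoints violates one of these facts. *)
by case: (c a1) (c a2) (c a3) (c b3) (c b2) (c b1) => [] [] [] [] [] [] *;
  match goal with H : ~ _ |- _ => by case: H end.
Qed.

Lemma has_rainbow_sub d (P : finPOrderType d) (L L' : rel P) k :
  subrel L L' -> has_rainbow L k -> has_rainbow L' k.
Proof.
move=> sLL' /existsP[s /andP[s_cov s_sorted]]; apply/existsP; exists s.
by rewrite /rainbow s_cov (sub_sorted sLL').
Qed.

Lemma queue_layout_of_linear_extension d (P : finPOrderType d) (L : rel P) k :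
  linear_extension L -> ~~ has_rainbow L k.+1 -> queue_layout P k.
Proof.
move=> Lext no_rainbow; apply/existsP; exists [set p | L p.1 p.2].
have LE x y : rel_of [set p | L p.1 p.2] x y = L x y by rewrite /rel_of inE.
apply/andP; split; last first.
  by apply: contra no_rainbow; apply: has_rainbow_sub => x y; rewrite LE.
have /and4P[irr tr tot ext] := Lext.
apply/and4P; split.
- by apply/forallP=> x; rewrite LE (forallP irr).
- apply/'forall_forallP=> x y; apply/forallP=> z; rewrite !LE.
  by have /'forall_forallP/(_ x y)/forallP := tr.
- by apply/'forall_forallP=> x y; rewrite !LE; have /'forall_forallP := tot.
- by apply/'forall_forallP=> x y; rewrite LE; have /'forall_forallP := ext.
Qed.

Theorem theorem2 (d : Order.disp_t) (P : finPOrderType d) :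
  width P = 2 -> (queue_number P <= 2)%N.
Proof.
move=> w2; have no3 : no_antichain3 P by apply: width2_no_antichain3; rewrite w2.
have [c chain_c] := two_chain_coloring no3.
have [s [sE s_pw s_lazy]] := ex_lazy_seq [set: P] true chain_c.
have s_full x : x \in s by rewrite sE inE.
have s_uniq : uniq s by apply: pairwise_uniq s_pw => x; rewrite lexx.
have Lext := index_linear_extension s_full s_pw.
have Llazy := lazy_seq_order s_uniq s_full s_lazy.
rewrite /queue_number; case: ex_minnP => k _; apply.
exact: queue_layout_of_linear_extension Lext (lazy_no_rainbow3 chain_c Lext Llazy).
Qed.
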